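(* Let $n>1$ be odd and let $\zeta\in\mathbb C$ be any primitive $n$th root of unity. For $j,k=1,\ldots,n-1$ let $$b_{jk}=\begin{cases}(1+\zeta^{j-k})/(1-\zeta^{j-k})&\text{if}\ j\neq k,\\1&\text{if}\ j=k.\end{cases}$$ Then for every $x\in\mathbb C$, $$\det[x+b_{jk}]_{1\leqslant j,k\leqslant n-1}=(-1)^{\frac{n+1}{2}}(nx+1)\frac{((n-1)!!)^2}{n(n-1)}.$$
   Context: For even $m$, $m!!$ denotes the product of all even positive integers up to $m$ (with $0!!=1$). *)

(* Defs.v *)
From HB Require Import structures.
From mathcomp Require Import all_boot all_order all_algebra.
From mathcomp Require Import reals complex.
Set Implicit Arguments.
Unset Strict Implicit.
Unset Printing Implicit Defensive.
Import Order.TTheory GRing.Theory Num.Theory.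
Local Open Scope ring_scope.

(* [m!!], used for even [m] only. *)
Definition even_dfact (m : nat) : nat :=
  (\prod_(1 <= i < m.+1 | ~~ odd i) i)%N.

(* The exponent is the signed integer [j - k]; [^] is the integer power. *)
Definition b (C : fieldType) (zeta : C) (j k : nat) : C :=
  if j == k then 1
  else (1 + zeta ^ (j%:Z - k%:Z)) / (1 - zeta ^ (j%:Z - k%:Z)).

(* Rows and columns are numbered from 1 to n - 1, while the elements of
   ['I_n.-1] are numbered from 0, hence the shift by one. *)
Definition shifted_b_mx (C : fieldType) (n : nat) (zeta x : C) : 'M[C]_n.-1 :=
  \matrix_(j < n.-1, k < n.-1) (x + b zeta j.+1 k.+1).

(* Main.v *)
(** Restoring the index [0] turns the matrix into the principal [(0, 0)] minor of
    the circulant matrix [x + b_{jk}], [0 <= j, k < n], which the Fourier matrix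
    [zeta^{kr}] diagonalizes with eigenvalues [n x + 1] (for [r = 0]) and
    [n + 1 - 2 r] (for [0 < r < n]).  As [n] is odd, the eigenvalue with
    [r = (n + 1) / 2] vanishes, so this minor is [1 / n] times the product of the
    remaining eigenvalues. *)
Require Import Defs.
From HB Require Import structures.
From mathcomp Require Import all_boot all_order all_algebra.
From mathcomp Require Import reals complex.
From mathcomp Require Import ring zify.
Set Implicit Arguments.
Unset Strict Implicit.
Unset Printing Implicit Defensive.
Import Order.TTheory GRing.Theory Num.Theory.
Local Open Scope ring_scope.
Local Open Scope complex_scope.

(** * Cofactors of a diagonalized matrix *)

Lemma cofactor_eq_rows (C : comPzRingType) (n : nat) (A B : 'M[C]_n) (i k : 'I_n) :
  (forall i' k', i' != i -> A i' k' = B i' k') ->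
  cofactor A i k = cofactor B i k.
Proof.
move=> eqAB; rewrite /cofactor; congr (_ * \det _).
by apply/matrixP => a c; rewrite !mxE eqAB // eq_sym neq_lift.
Qed.

(** Deleting column [r0] deletes the factor [lam r0]; the other column scalings come out of the
    determinant. *)
Lemma cofactor_mul_diag (C : comPzRingType) (n : nat) (F : 'M[C]_n)
    (lam : 'I_n -> C) (i r0 : 'I_n) :
  cofactor (\matrix_(k, r) (F k r * lam r)) i r0 =
    cofactor F i r0 * \prod_(r | r != r0) lam r.
Proof.
rewrite /cofactor -mulrA; congr (_ * _).
have -> : row' i (col' r0 (\matrix_(k, r) (F k r * lam r))) =
    row' i (col' r0 F) *m diag_mx (\row_r lam (lift r0 r)).
  by rewrite mul_mx_diag; apply/matrixP => a c; rewrite !mxE.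
rewrite det_mulmx det_diag; congr (_ * _).
rewrite (reindex_omap (lift r0) (unlift r0)) /=; last first.
  by move=> r; case: unliftP => [k ->|->]; rewrite ?eqxx.
by apply: eq_big => [r|r _]; rewrite ?mxE // liftK eqxx eq_sym neq_lift.
Qed.

(* If [lam r0 = 0], replacing row [i0] of [M] by the [i0]-th unit vector leaves
   [A] with [A *m F] having a single nonzero entry in column [r0]. *)
Lemma cofactor_diagonalized (C : fieldType) (n : nat) (M F G : 'M[C]_n)
    (lam : 'I_n -> C) (c : C) (i0 r0 : 'I_n) :
  c != 0 -> G *m F = c%:M ->
  M *m F = \matrix_(k, r) (F k r * lam r) -> lam r0 = 0 ->
  cofactor M i0 i0 = F i0 r0 * G r0 i0 / c * \prod_(r | r != r0) lam r.
Proof.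
move=> c0 GF MF lam0.
have detF0 : \det F != 0.
  apply/eqP => detF; have := congr1 determinant GF.
  rewrite det_mulmx detF mulr0 det_scalar => /esym/eqP.
  by rewrite expf_eq0 (negPf c0) andbF.
pose A := \matrix_(i, k) (if i == i0 then (k == i0)%:R else M i k).
have detA : \det A = cofactor M i0 i0.
  rewrite (expand_det_row A i0) (bigD1 i0) //= big1 ?addr0 => [|k /negPf ki0].
    rewrite mxE !eqxx mul1r; apply: cofactor_eq_rows => i k /negPf ii0.
    by rewrite mxE ii0.
  by rewrite mxE eqxx ki0 mul0r.
have AF i r : (A *m F) i r = if i == i0 then F i0 r else F i r * lam r.
  rewrite mxE; case: ifPn => [/eqP->|/negPf ii0].
    rewrite (bigD1 i0) //= big1 ?addr0 => [|k /negPf ki0].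
      by rewrite mxE !eqxx mul1r.
    by rewrite mxE eqxx ki0 mul0r.
  have := congr1 (fun X : 'M_n => X i r) MF; rewrite !mxE => <-.
  by apply: eq_bigr => k _; rewrite mxE ii0.
have detAF : \det (A *m F) = F i0 r0 * (cofactor F i0 r0 * \prod_(r | r != r0) lam r).
  rewrite (expand_det_col _ r0) (bigD1 i0) //= big1 ?addr0 => [|k /negPf ki0].
    rewrite AF eqxx -cofactor_mul_diag; congr (_ * _).
    by apply: cofactor_eq_rows => i r /negPf ii0; rewrite AF ii0 mxE.
  by rewrite AF ki0 lam0 mulr0 mul0r.
(* Evaluating [G *m F *m \adj F] in two ways gives [c \adj F = \det F G]. *)
have cofF : c * cofactor F i0 r0 = \det F * G r0 i0.
  have := mulmxA G F (\adj F).
  rewrite GF mul_mx_adj mul_mx_scalar mul_scalar_mx.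
  by move=> /matrixP/(_ r0 i0); rewrite !mxE.
apply: (mulIf detF0); rewrite -detA -det_mulmx detAF.
have -> : cofactor F i0 r0 = \det F * G r0 i0 / c by rewrite -cofF mulrC mulKf.
by ring.
Qed.

Lemma sum_exp_unity_root (C : fieldType) (n : nat) (y : C) :
  y ^+ n = 1 -> \sum_(i < n) y ^+ i = if y == 1 then n%:R else 0.
Proof.
move=> yn; case: ifPn => [/eqP->|y1].
  by under eq_bigr do rewrite expr1n; rewrite sumr_const card_ord.
have := subrX1 y n; rewrite yn subrr => /esym/eqP.
by rewrite mulf_eq0 subr_eq0 (negPf y1) => /eqP.
Qed.

Lemma b_diag (C : fieldType) (z : C) (j : nat) : b z j j = 1.
Proof. by rewrite /b eqxx. Qed.

(** Numerator and denominator are multiplied by [w = z ^ (k - j)], so that [b] times [w - 1] is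
    simply [w + 1]. *)
Lemma bE (C : fieldType) (z : C) (j k : nat) : z != 0 -> j != k ->
  z ^+ k / z ^+ j != 1 ->
  b z j k = (z ^+ k / z ^+ j + 1) / (z ^+ k / z ^+ j - 1).
Proof.
move=> z0 /negPf jk w1; rewrite /b jk expfzDr // -invr_expz -!exprnP.
have zj0 : z ^+ j != 0 by rewrite expf_neq0.
have zk0 : z ^+ k != 0 by rewrite expf_neq0.
have d0 : z ^+ k - z ^+ j != 0.
  by rewrite subr_eq0; apply: contraNneq w1 => ->; rewrite divff.
by field; rewrite mulN1r d0 zj0 zk0.
Qed.

(** * Fourier diagonalization of the circulant matrix *)

Section Circulant.

Variables (C : numFieldType) (n : nat) (zeta : C).
Hypothesis zeta_prim : n.-primitive_root zeta.

Let n_gt0 : (0 < n)%N := prim_order_gt0 zeta_prim.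

Let zeta_neq0 : zeta != 0.
Proof.
by apply/eqP => z0; have := prim_expr_order zeta_prim; rewrite z0 expr0n gtn_eqF //
  => /esym/eqP; rewrite oner_eq0.
Qed.

Lemma prim_ratio_exp (k j : nat) : (zeta ^+ k / zeta ^+ j) ^+ n = 1.
Proof.
by rewrite exprMn exprVn -!exprM !(mulnC _ n) !exprM (prim_expr_order zeta_prim)
  !expr1n divr1.
Qed.

Lemma prim_ratio_eq1 (k j : 'I_n) : (zeta ^+ k / zeta ^+ j == 1) = (k == j).
Proof.
have zj0 : zeta ^+ j != 0 by rewrite expf_neq0.
by rewrite -(inj_eq (mulIf zj0)) divfK // mul1r (eq_prim_root_expr zeta_prim) !modn_small.
Qed.

Lemma sum_prim_ratio (j : 'I_n) (r : nat) :
  \sum_(k < n) (zeta ^+ k / zeta ^+ j) ^+ r = if (n %| r)%N then n%:R else 0.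
Proof.
have -> : \sum_(k < n) (zeta ^+ k / zeta ^+ j) ^+ r =
    (\sum_(k < n) (zeta ^+ r) ^+ k) / zeta ^+ j ^+ r.
  rewrite mulr_suml; apply: eq_bigr => k _.
  by rewrite exprMn exprVn -!exprM (mulnC r).
rewrite sum_exp_unity_root; last first.
  by rewrite -exprM mulnC exprM (prim_expr_order zeta_prim) expr1n.
rewrite -(prim_order_dvd zeta_prim); case: ifP => [/dvdnP[q ->]|_]; last by rewrite mul0r.
by rewrite -exprM mulnA mulnC exprM (prim_expr_order zeta_prim) expr1n divr1.
Qed.

(** Off-diagonal contribution to the [r]-th eigenvalue at [x = 0], read off from row [j]. *)
Let T (j : 'I_n) (r : nat) : C :=
  \sum_(k < n | k != j) b zeta j k * (zeta ^+ k / zeta ^+ j) ^+ r.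

(** With [w = zeta ^ (k - j)], [b (w ^ (r + 1) - w ^ r) = w ^ (r + 1) + w ^ r]. Both power sums are
    completed to all [k], and the [- 2] removes the two added terms [k = j]. *)
Let T_succ (j : 'I_n) (r : nat) :
  T j r.+1 = T j r + (if (n %| r.+1)%N then n%:R else 0)
    + (if (n %| r)%N then n%:R else 0) - 2.
Proof.
have -> : T j r.+1 = T j r + \sum_(k < n | k != j)
    ((zeta ^+ k / zeta ^+ j) ^+ r.+1 + (zeta ^+ k / zeta ^+ j) ^+ r).
  rewrite /T -big_split; apply: eq_bigr => k kj /=.
  have w1 : zeta ^+ k / zeta ^+ j != 1 by rewrite prim_ratio_eq1.
  rewrite bE //; last by rewrite eq_sym.
  move: (zeta ^+ k / zeta ^+ j) w1 => w w1.
  have w10 : w - 1 != 0 by rewrite subr_eq0.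
  by rewrite exprS; field.
rewrite -!(sum_prim_ratio j) !(bigD1 (P := predT) j) //= big_split /= divff ?expf_neq0 //.
by rewrite !expr1n; ring.
Qed.

(** Only the step from [r = 0] gains [n]; every step loses 2. *)
Let T_pos (j : 'I_n) (r : nat) : (r.+1 < n)%N ->
  T j r.+1 = T j 0 + n%:R - r.+1%:R *+ 2.
Proof.
elim: r => [|r IHr] lt_r; rewrite T_succ (gtnNdvd _ lt_r) //.
  by rewrite dvdn0 addr0; ring.
by rewrite IHr 1?ltnW // (gtnNdvd _ (ltnW lt_r)) // -!natr1; ring.
Qed.

(* Summing over a full period of [r] kills each term, which pins down the
   constant left free by the recurrence [T_succ]. *)
Let T0 (j : 'I_n) : T j 0 = 0.
Proof.
have sumT : \sum_(r < n) T j r = 0.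
  rewrite exchange_big big1 // => k kj.
  by rewrite -mulr_sumr sum_exp_unity_root ?prim_ratio_exp // prim_ratio_eq1 (negPf kj) mulr0.
have part (m : nat) : (m < n)%N ->
    \sum_(r < m.+1) T j r = m.+1%:R * T j 0 + m%:R * (n%:R - m.+1%:R).
  elim: m => [|m IHm] lt_m; first by rewrite big_ord1; ring.
  by rewrite big_ord_recr /= IHm 1?ltnW // T_pos // -!natr1; ring.
(* At [m = n - 1] the last term of [part] vanishes, leaving [n * T j 0 = 0]. *)
have := part n.-1; rewrite (prednK n_gt0) leqnn sumT => /(_ isT)/esym/eqP.
by rewrite subrr mulr0 addr0 mulf_eq0 pnatr_eq0 eqn0Ngt n_gt0 => /eqP.
Qed.

Definition circulant_eigenvalue (x : C) (r : nat) : C :=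
  if r == 0%N then n%:R * x + 1 else n.+1%:R - r%:R *+ 2.

Lemma circulant_eigenvector (x : C) (j r : 'I_n) :
  \sum_(k < n) (x + b zeta j k) * zeta ^+ (k * r) =
    zeta ^+ (j * r) * circulant_eigenvalue x r.
Proof.
have zj0 : zeta ^+ (j * r) != 0 by rewrite expf_neq0.
have -> : \sum_(k < n) (x + b zeta j k) * zeta ^+ (k * r) = zeta ^+ (j * r) *
    (x * (\sum_(k < n) (zeta ^+ k / zeta ^+ j) ^+ r) + (1 + T j r)).
  have -> : 1 + T j r = \sum_(k < n) b zeta j k * (zeta ^+ k / zeta ^+ j) ^+ r.
    by rewrite (bigD1 (P := predT) j) //= divff ?expf_neq0 // expr1n b_diag mul1r.
  rewrite mulr_sumr -big_split mulr_sumr; apply: eq_bigr => k _ /=.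
  by rewrite -mulrDl exprMn exprVn -!exprM mulrCA mulrC mulrA -[LHS]mulr1 -(divff zj0); ring.
(* The coefficient of [x] is a full power sum, so [x] survives only for [r = 0]. *)
congr (_ * _); rewrite sum_prim_ratio /circulant_eigenvalue.
case: r {zj0} => [[|r] lt_r] /=; first by rewrite dvdn0 T0; ring.
by rewrite (gtnNdvd _ lt_r) // T_pos // T0 -natr1; ring.
Qed.

Lemma circulant_cofactor (x : C) (i0 r0 : 'I_n) : circulant_eigenvalue x r0 = 0 ->
  cofactor (\matrix_(j < n, k < n) (x + b zeta j k)) i0 i0 =
    (\prod_(r < n | r != r0) circulant_eigenvalue x r) / n%:R.
Proof.
move=> ev0.
pose F := \matrix_(k < n, r < n) zeta ^+ (k * r).
(* [G] is [n] times the inverse of [F], and its entries invert those of the transpose of [F], so the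
   prefactor is exactly [1 / n]. *)
pose G := \matrix_(r < n, k < n) (zeta ^+ (k * r))^-1.
have n0 : n%:R != 0 :> C by rewrite pnatr_eq0 -lt0n.
rewrite (@cofactor_diagonalized _ _ _ F G (circulant_eigenvalue x) n%:R i0 r0) //.
- by rewrite !mxE divff ?expf_neq0 // mul1r mulrC.
- apply/matrixP => s r; rewrite !mxE.
  transitivity (\sum_(k < n) (zeta ^+ r / zeta ^+ s) ^+ k).
    by apply: eq_bigr => k _; rewrite !mxE exprMn exprVn -!exprM mulrC !(mulnC k).
  rewrite sum_exp_unity_root ?prim_ratio_exp // prim_ratio_eq1 eq_sym.
  by case: (s == r).
- apply/matrixP => j r; rewrite !mxE -circulant_eigenvector.
  by apply: eq_bigr => k _; rewrite !mxE.
Qed.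

End Circulant.

(** * Evaluation of the eigenvalue product *)

Lemma even_dfact_double (h : nat) : even_dfact h.*2 = (2 ^ h * h`!)%N.
Proof.
rewrite /even_dfact big_mkcond; elim: h => [|h IHh]; first by rewrite big_geq.
by rewrite doubleS big_nat_recr // big_nat_recr //= IHh odd_double /= factS expnS
  -doubleS -mul2n; ring.
Qed.

Lemma double_factE (h : nat) : (2 ^ h * h`! = \prod_(i < h) i.+1.*2)%N.
Proof.
elim: h => [|h IHh]; first by rewrite big_ord0.
by rewrite big_ord_recr /= -IHh factS expnS -mul2n; ring.
Qed.

(** Here [n + 1 = 2 (h + 2)]: the eigenvalues for [0 < r < h + 2] are [2h + 2, ..., 4, 2], and those
    for [h + 2 < r < n] are [-2, -4, ..., -2h]. *)
Lemma prod_circulant_eigenvalue (C : numFieldType) (h : nat) (x : C)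
    (n := h.+1.*2.+1) (r0 : 'I_n) : r0 = h.+2 :> nat ->
  \prod_(r < n | r != r0) circulant_eigenvalue n x r =
    (n%:R * x + 1) * (2 ^ h.+1 * h.+1`!)%:R * ((-1) ^+ h * (2 ^ h * h`!)%:R).
Proof.
move=> r0E.
have -> : \prod_(r < n | r != r0) circulant_eigenvalue n x r =
    \prod_(0 <= r < n | r != h.+2) circulant_eigenvalue n x r.
  by rewrite big_mkord; apply: eq_bigl => r; rewrite -r0E.
have -> : (2 ^ h.+1 * h.+1`!)%:R =
    \prod_(1 <= r < h.+2) circulant_eigenvalue n x r.
  (* The eigenvalues decrease with [r], hence the reversal of the index. *)
  rewrite double_factE natr_prod big_add1 big_mkord (reindex_inj rev_ord_inj).
  apply: eq_bigr => i _; rewrite /circulant_eigenvalue -[_ *+ 2]mulr_natr -natrM.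
  by rewrite -natrB /n; [congr _%:R|]; have := ltn_ord i; rewrite /=; lia.
have -> : (-1) ^+ h * (2 ^ h * h`!)%:R =
    \prod_(h.+3 <= r < n) circulant_eigenvalue n x r.
  have nE : n = (h + h.+3)%N by rewrite /n; lia.
  rewrite [X in index_iota _ X]nE -[X in index_iota X _]add0n big_addn addnK big_mkord.
  rewrite double_factE natr_prod -[in (-1) ^+ h](card_ord h) -prodrN.
  apply: eq_bigr => i _; rewrite /circulant_eigenvalue addnS nE /=.
  by rewrite -[_ *+ 2]mulr_natr -natrM -[RHS]opprB -natrB; [congr (- _%:R)|]; lia.
rewrite big_ltn_cond //= (@big_cat_nat _ _ _ h.+2) //=; last by rewrite /n; lia.
rewrite (@big_ltn_cond _ _ _ h.+2) ?eqxx /=; last by rewrite /n; lia.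
rewrite mulrA; congr (_ * _ * _).
  by rewrite big_nat_cond [RHS]big_nat_cond; apply: eq_bigl => r; lia.
by rewrite big_nat_cond [RHS]big_nat_cond; apply: eq_bigl => r; lia.
Qed.

Theorem theorem1p3 (R : realType) (n : nat) (zeta : R[i])
    (n_gt1 : (1 < n)%N) (n_odd : odd n)
    (zeta_prim : n.-primitive_root zeta) (x : R[i]) :
  \det (shifted_b_mx n zeta x) =
    (-1) ^+ (n.+1)./2 * (n%:R * x + 1) *
      ((even_dfact n.-1)%:R ^+ 2 / (n%:R * (n.-1)%:R)).
Proof.
have [h nE] : exists h, n = h.+1.*2.+1 by exists n.-1./2.-1; lia.
subst n; set n := h.+1.*2.+1 in zeta_prim *.
have lt_r0 : (h.+2 < n)%N by rewrite /n; lia.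
have ev0 : circulant_eigenvalue n x (Ordinal lt_r0) = 0.
  rewrite /circulant_eigenvalue /= -[_ *+ 2]mulr_natr -natrM.
  by apply/eqP; rewrite subr_eq0 eqr_nat /n; lia.
have -> : \det (shifted_b_mx n zeta x) =
    cofactor (\matrix_(j < n, k < n) (x + b zeta j k)) ord0 ord0.
  (* Deleting row and column 0 lifts each index by one, which is the shift in [shifted_b_mx]. *)
  rewrite /cofactor expr0 mul1r; congr (\det _).
  by apply/matrixP => j k; rewrite !mxE.
rewrite (circulant_cofactor zeta_prim ord0 ev0) prod_circulant_eigenvalue //.
rewrite even_dfact_double.
have -> : (n.+1./2 = h.+2)%N by rewrite /n; lia.
have n0 : n%:R != 0 :> R[i] by rewrite pnatr_eq0.
have -> : n.-1 = (2 * h.+1)%N by rewrite /n; lia.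
have h0 : h.+1%:R != 0 :> R[i] by rewrite pnatr_eq0.
(* Since [n - 1 = 2 (h + 1)], the factor [2 ^ h * h!] is [(n - 1)!! / (n - 1)]; the signs agree
   because [h] and [h + 2] have the same parity. *)
rewrite factS expnS !exprS !natrM natrX.
move: n%:R n0 h.+1%:R h0 => N n0 H h0.
by field; rewrite n0 h0.
Qed.
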